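(* Let $G$ be a graph satisfying $\mathcal{E}_2$. Then a finite path $t$ on $G$ can be extended to a two-way infinite Eulerian path on $G$ if and only if it satisfies the following three conditions: (1) $G-t$ has no finite connected components; (2) there is an edge $e$ incident to the final vertex of $t$ which was not visited by $t$; (3) there is an edge $f\neq e$ incident to the initial vertex of $t$ which was not visited by $t$. (Conditions (2) and (3) together ask for the existence of two distinct edges $e,f$ as described.)
   Context: Graphs are undirected, finite or infinite; loops and multiple edges are allowed. Each edge joins a pair of (possibly equal) vertices and is incident to them. The degree $\deg_G(v)\in\mathbb{N}\cup\{\infty\}$ is the number of edges incident to $v$, loops counted twice; ''even degree'' means finite and even. A graph is finite if its edge set is finite, and infinite otherwise. A graph homomorphism sends vertices to vertices and edges to edges, compatibly with incidence. $\llbracket a,b\rrbracket$ (integers $a\le b$) is the graph with vertex set $\{a,\dots,b\}$ and an edge $\{c,c+1\}$ joining $c$ to $c+1$ for each $a\le c<b$; $\llbracket\mathbb{Z}\rrbracket$ is defined similarly. A path, also called finite path (resp. two-way infinite path), on $G$ is a graph homomorphism from some $\llbracket a,b\rrbracket$ (resp. from $\llbracket\mathbb{Z}\rrbracket$) to $G$ that does not repeat edges (vertices may repeat). It visits the vertices and edges in its image, and is Eulerian if it visits every edge of $G$ exactly once. The initial and final vertices of $t\colon\llbracket a,b\rrbracket\to G$ are $t(a)$ and $t(b)$. A two-way infinite path extends the finite path $t$ if its restriction to the domain of $t$ equals $t$. $G$ is connected if every pair of vertices is joined by a path. For a set of edges $E\subset E(G)$, $G[E]$ is the subgraph with edge set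 $E$ and vertex set the vertices incident to some edge in $E$; $G-E$ is $G[E(G)\setminus E]$ (remove the edges in $E$, then all vertices left without incident edges). For a path $t$, $G-t$ is $G-E$ with $E$ the set of edges visited by $t$. A connected component is a maximal connected subgraph. The number of ends of $G$ is the supremum, over finite sets $E$ of edges, of the number of infinite connected components of $G-E$. $G$ satisfies $\mathcal{E}_2$ if: $E(G)$ is countable and infinite; $G$ is connected; the degree of each vertex is infinite or even; $G$ has one or two ends, and moreover, whenever $E$ is a finite set of edges such that all vertices of $G[E]$ have even degree in $G[E]$, the graph $G-E$ has one infinite connected component. *)

(* Defs.v *)
From HB Require Import structures.
From mathcomp Require Import all_boot all_order all_algebra.
From mathcomp Require Import finmap.
From mathcomp Require Import all_classical.

Set Implicit Arguments.
Unset Strict Implicit.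
Unset Printing Implicit Defensive.

Import Order.TTheory GRing.Theory Num.Theory.
Local Open Scope classical_set_scope.
Local Open Scope card_scope.

(* Undirected multigraphs with loops. The order of the two components of
   [ends e] carries no meaning: edges are only inspected through [joins],
   [incident] and [loop] (and subgraphs inherit [ends]). *)
Record graph := Graph {
  vertex : Type;
  edge : Type;
  ends : edge -> vertex * vertex }.

Arguments Graph {vertex edge} ends.
Arguments ends {g} e.

Section Incidence.
Variable G : graph.
Implicit Types (e : edge G) (u v : vertex G).

Definition joins e u v : Prop := ends e = (u, v) \/ ends e = (v, u).

Definition incident e v : Prop := (ends e).1 = v \/ (ends e).2 = v.

Definition loop e v : Prop := ends e = (v, v).

(* [None] stands for an infinite degree. A loop at v belongs to both sets
   below, hence counts twice. *)
Definition degree v : option nat :=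
  if `[< finite_set [set e | incident e v] >] then
    Some (#|` fset_set ([set e | incident e v] : set {classic edge G}) |
          + #|` fset_set ([set e | loop e v] : set {classic edge G}) |)%N
  else None.

Definition infinite_degree v : Prop := degree v = None.

Definition even_degree v : Prop :=
  exists2 d : nat, degree v = Some d & ~~ odd d.

Definition finite_graph : Prop := finite_set [set: edge G].

End Incidence.

Record hom (G H : graph) := Hom {
  vmap : vertex G -> vertex H;
  emap : edge G -> edge H;
  hom_joins : forall e u v, joins e u v -> joins (emap e) (vmap u) (vmap v) }.

Section Lines.
Local Open Scope ring_scope.

Lemma left_end_subproof (a b c : int) : a <= c < b -> a <= c <= b.
Proof. by case/andP=> -> /ltW ->. Qed.

Lemma right_end_subproof (a b c : int) : a <= c < b -> a <= c + 1 <= b.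
Proof.
by case/andP=> ac cb; rewrite lezD1 cb andbT (le_trans ac) // lerDl.
Qed.

(* The edge indexed by c joins c to c + 1. *)
Definition interval_graph (a b : int) : graph :=
  @Graph {c : int | a <= c <= b} {c : int | a <= c < b}
    (fun c => (exist _ (val c) (left_end_subproof (valP c)),
               exist _ (val c + 1) (right_end_subproof (valP c)))).

Definition int_graph : graph := Graph (fun c : int => (c, c + 1)).

Lemma lo_subproof (a b : int) : a <= b -> a <= a <= b.
Proof. by move=> ->; rewrite lexx. Qed.

Lemma hi_subproof (a b : int) : a <= b -> a <= b <= b.
Proof. by move=> ->; rewrite lexx. Qed.

End Lines.

Record trail (D G : graph) := Trail {
  trail_hom :> hom D G;
  trail_inj : injective (emap trail_hom) }.

Record finite_path (G : graph) := FinitePath {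
  lo : int;
  hi : int;
  lo_le_hi : (lo <= hi)%R;
  finite_trail :> trail (interval_graph lo hi) G }.

Definition two_way_path (G : graph) := trail int_graph G.

Section Paths.
Variable G : graph.

Definition initial_vertex (t : finite_path G) : vertex G :=
  vmap t (exist _ (lo t) (lo_subproof (lo_le_hi t))).

Definition final_vertex (t : finite_path G) : vertex G :=
  vmap t (exist _ (hi t) (hi_subproof (lo_le_hi t))).

Definition visited_edges (t : finite_path G) : set (edge G) := range (emap t).

Definition eulerian (D : graph) (T : trail D G) : Prop :=
  forall e : edge G, exists! c : edge D, emap T c = e.

Definition extends (T : two_way_path G) (t : finite_path G) : Prop :=
  (forall c : vertex (interval_graph (lo t) (hi t)),
     vmap T (val c) = vmap t c) /\
  (forall c : edge (interval_graph (lo t) (hi t)),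
     emap T (val c) = emap t c).

Definition connected : Prop :=
  forall u v : vertex G,
    exists t : finite_path G, initial_vertex t = u /\ final_vertex t = v.

End Paths.

Record subgraph (G : graph) := Subgraph {
  sub_vertices : set (vertex G);
  sub_edges : set (edge G);
  sub_closed : forall e v, sub_edges e -> incident e v -> sub_vertices v }.

Section Subgraphs.
Variable G : graph.
Implicit Types (H K C : subgraph G) (E : set (edge G)).

Lemma end1_subproof H (e : sub_edges H) :
  (ends (val e)).1 \in sub_vertices H.
Proof. by apply/mem_set/(sub_closed (set_valP e)); left. Qed.

Lemma end2_subproof H (e : sub_edges H) :
  (ends (val e)).2 \in sub_vertices H.
Proof. by apply/mem_set/(sub_closed (set_valP e)); right. Qed.

Definition graph_of_subgraph H : graph :=
  @Graph (sub_vertices H) (sub_edges H)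
    (fun e => (SigSub (end1_subproof e), SigSub (end2_subproof e))).

Definition is_subgraph H K : Prop :=
  sub_vertices H `<=` sub_vertices K /\ sub_edges H `<=` sub_edges K.

Lemma edge_subgraph_subproof E e v :
  E e -> incident e v -> [set w | exists2 e', E e' & incident e' w] v.
Proof. by move=> Ee ev; exists e. Qed.

(* G[E] *)
Definition edge_subgraph E : subgraph G :=
  Subgraph (@edge_subgraph_subproof E).

(* G - E; vertices left without incident edges are removed as well. *)
Definition remove_edges E : subgraph G := edge_subgraph (~` E).

Definition component H C : Prop :=
  [/\ is_subgraph C H, connected (graph_of_subgraph C) &
      forall K, is_subgraph K H -> connected (graph_of_subgraph K) ->
        is_subgraph C K -> is_subgraph K C].

Definition infinite_components H : set (subgraph G) :=
  [set C | component H C /\ ~ finite_graph (graph_of_subgraph C)].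

Definition ends_bound (n : nat) : Prop :=
  forall E, finite_set E -> infinite_components (remove_edges E) #<= `I_n.

(* The number of ends, a supremum in the extended natural numbers, equals the
   natural number n. *)
Definition number_of_ends_is (n : nat) : Prop :=
  ends_bound n /\ forall m : nat, ends_bound m -> (n <= m)%N.

End Subgraphs.

Coercion graph_of_subgraph : subgraph >-> graph.

Definition property_E2 (G : graph) : Prop :=
  [/\ countable [set: edge G] /\ infinite_set [set: edge G],
      connected G,
      forall v : vertex G, infinite_degree v \/ even_degree v,
      number_of_ends_is G 1 \/ number_of_ends_is G 2 &
      forall E : set (edge G), finite_set E ->
        (forall v : vertex (edge_subgraph E), even_degree v) ->
        infinite_components (remove_edges E) #= `I_1].

(* Main.v *)
Require Import Defs.
From mathcomp Require Import all_boot all_order all_algebra.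
From mathcomp Require Import zify.
From mathcomp Require Import all_classical.

(** Necessity is immediate: each of the two rays left over from a two-way
infinite Eulerian path is infinite and every unvisited edge lies on one of
them, so the component of such an edge is infinite; the first edges of the two
rays are the edges [e] and [f] ([extends_necessary]).

For sufficiency, call a trail extendable when it satisfies the three
conditions.  It is enough to show that an extendable trail can be lengthened
on both sides, through any prescribed edge, to another extendable trail
([extend_both_sides]): doing this for every edge in turn and taking the limit
gives the Eulerian path.

Let [t] be extendable, going from [a] to [b], and let [e] be an unvisited edge
in the component of [b] in [G - t].  Take a trail [p] in [G - t] that starts at
[b], goes through [e] and ends at [w], and let [K] be the set of edges lying in
finite components of [G - t - p].  As [G - t] has no finite component, each
edge of [K] is attached to [p]; hence [K] is finite, [p] together with [K] is
connected, and removing it leaves only infinite components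
([absorb_finite_components]).  Every vertex incident to [K] has finite, hence
even, degree in [G], so its degree in [K] has the parity of its degree in [t]
and [p] together: only [a] and [w] can be odd.  No finite graph has a single
odd vertex, so two cases remain.

- [K] has no odd vertex and [w] is not [a].  Then [p] and [K] together have an
  Eulerian trail from [b] to [w].  The lengthened trail runs from [a] to [w],
  which are odd in what it visits, so each of them keeps an unvisited edge; the
  two edges can be chosen distinct since a single shared edge would be a finite
  component.

- The odd vertices of [K] are exactly [a] and [w] (none if they coincide).
  Then [p] and [K] together have an Eulerian trail from [b] to [a].  The
  component of [b] is infinite, so this trail passes through a vertex [x] with
  an unvisited edge.  Cutting it at [x], and appending the part from [b] to [x]
  at the end of [t] and the part from [x] to [a] at its beginning, gives a
  closed trail based at [x]; by parity [x] has two unvisited edges.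

This is [extend_through].  The property [E_2] says that each unvisited edge
lies in the component of [a] or in that of [b] ([unvisited_reachable]): if [a]
and [b] are in different components, a third one would give three infinite
components after removing finitely many edges; if they are in the same
component, closing [t] by a trail from [b] to [a] removes a finite set of edges
with all degrees even, which leaves one infinite component. *)

Set Implicit Arguments.
Unset Strict Implicit.
Unset Printing Implicit Defensive.

Import Order.TTheory GRing.Theory Num.Theory.
Local Open Scope classical_set_scope.

Lemma perm_cat_filterN (T : eqType) (s R : seq T) :
  uniq s -> uniq R -> {subset s <= R} ->
  perm_eq (s ++ [seq d <- R | d \notin s]) R.
Proof.
move=> us uR sR; apply: uniq_perm => // [|d].
  rewrite cat_uniq us filter_uniq // andbT.
  by apply/hasPn => d; rewrite mem_filter => /andP[].
by rewrite mem_cat mem_filter; case: (boolP (d \in s)) => // /sR ->.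
Qed.

(** * Walks, reachability and components *)

Section Walks.
Variable G : graph.
Local Notation V := {classic (vertex G)}.
Local Notation E := {classic (edge G)}.
Implicit Types (u v w x y z a b : V) (e d g h : E) (p q s R : seq E).
Implicit Type S : set E.

Lemma joinsC e u v : joins e u v -> joins e v u.
Proof. by case; [right|left]. Qed.

Lemma joins_incidentl e u v : joins e u v -> incident e u.
Proof. by case=> eE; rewrite /incident eE; [left|right]. Qed.

Lemma joins_incidentr e u v : joins e u v -> incident e v.
Proof. by move/joinsC/joins_incidentl. Qed.

Lemma incident_joins e u : incident e u -> exists v, joins e u v.
Proof.
rewrite /incident /joins; case: (ends e) => a b /= [<-|<-].
  by exists b; left.
by exists a; right.
Qed.

Lemma joins_incident e u v x : joins e u v -> incident e x -> x = u \/ x = v.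
Proof.
by case=> eE; rewrite /incident eE /= => -[]<-; [left|right|right|left].
Qed.

Lemma incident_fst e : incident e (ends (e : edge G)).1.
Proof. by left. Qed.

(** Walks are lists of edges, so that a trail is a walk whose list is [uniq],
and concatenation and rearrangement of trails are operations on lists.  The
intermediate vertices are determined by the start and the edges. *)
Fixpoint walk u s v : Prop :=
  if s is e :: s' then exists2 w : V, joins e u w & walk w s' v else u = v.

Lemma walk_cat u s1 s2 v :
  walk u (s1 ++ s2) v <-> exists2 w, walk u s1 w & walk w s2 v.
Proof.
elim: s1 u => [|e s1 IH] u /=.
  by split=> [|[w ->]]; first by exists u.
split=> [[w euw /IH[w' ? ?]]|[w [w' euw ?] ?]].
  by exists w' => //; exists w.
by exists w' => //; apply/IH; exists w.
Qed.

Lemma walk1 e u v : walk u [:: e] v <-> joins e u v.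
Proof. by split=> [[w euw <-]|] //=; exists v. Qed.

Lemma walk_rev u s v : walk u s v -> walk v (rev s) u.
Proof.
elim: s u => [|e s IH] u //= [w euw ws].
rewrite rev_cons -cats1; apply/walk_cat; exists w; first exact: IH.
exact/walk1/joinsC.
Qed.

Lemma walk_split u s v e x : walk u s v -> e \in s -> incident e x ->
  exists s1 s2, [/\ s = s1 ++ s2, walk u s1 x & walk x s2 v].
Proof.
elim: s u => [|d s IH] u //= [w duw ws]; rewrite inE => /predU1P[->|es] ex.
  case: (joins_incident duw ex) => ->.
    by exists [::], (d :: s); split=> //; exists w.
  by exists [:: d], s; split=> //; exists w.
have [s1 [s2 [-> ws1 ws2]]] := IH _ ws es ex.
by exists (d :: s1), s2; split=> //; exists w.
Qed.

Lemma walk_uniq u s v : walk u s v ->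
  exists s', [/\ uniq s', walk u s' v & {subset s' <= s}].
Proof.
elim: s u => [|e s IH] u /=; first by exists [::].
case=> w euw /IH[s' [us' ws' sub]].
have sub1 : {subset e :: s' <= e :: s}.
  by move=> d; rewrite !inE => /orP[->|/sub->]//; rewrite orbT.
have [es'|es'] := boolP (e \in s'); last first.
  by exists (e :: s'); split=> //=; [rewrite es'|exists w].
(* [e] is used again later, so [u] is revisited and the detour is skipped *)
have [s1 [s2 [def ws1 ws2]]] := walk_split ws' es' (joins_incidentl euw).
exists s2; split=> //; first by move: us'; rewrite def cat_uniq => /and3P[].
by move=> d ds2; apply: sub1; rewrite inE def mem_cat ds2 !orbT.
Qed.

Definition reach S u v := exists2 s, walk u s v & forall e, e \in s -> S e.

Lemma reach_refl S u : reach S u u. Proof. by exists [::]. Qed.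

Lemma reach_trans S u v w : reach S u v -> reach S v w -> reach S u w.
Proof.
move=> [s1 w1 S1] [s2 w2 S2]; exists (s1 ++ s2).
  by apply/walk_cat; exists v.
by move=> e; rewrite mem_cat => /orP[/S1|/S2].
Qed.

Lemma reach_sym S u v : reach S u v -> reach S v u.
Proof.
move=> [s ws sS]; exists (rev s); first exact: walk_rev.
by move=> e; rewrite mem_rev => /sS.
Qed.

Lemma sub_reach S S' u v : S `<=` S' -> reach S u v -> reach S' u v.
Proof. by move=> sub [s ws sS]; exists s => // e /sS/sub. Qed.

Lemma reach_joins S e u v : S e -> joins e u v -> reach S u v.
Proof.
move=> Se euv; exists [:: e]; first exact/walk1.
by move=> d; rewrite inE => /eqP->.
Qed.

Lemma reach_edge S e u v : S e -> incident e u -> incident e v -> reach S u v.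
Proof.
move=> Se /incident_joins[w euw] ev; have euw' := euw.
case: (joins_incident euw ev) => ->; first exact: reach_refl.
exact: reach_joins Se euw.
Qed.

Lemma reach_ind S (P : V -> Prop) u v :
  (forall e x y, S e -> joins e x y -> P x -> P y) ->
  reach S u v -> P u -> P v.
Proof.
move=> IP [s]; elim: s u => [|e s IH] u /= => [->|[w euw ws] sS] // Pu.
apply: (IH w) => // [d ds|]; first by apply: sS; rewrite inE ds orbT.
by apply: (IP _ _ _ _ euw Pu); apply: sS; rewrite inE eqxx.
Qed.

Lemma walk_reach u s v e x : walk u s v -> e \in s -> incident e x ->
  reach [set` s] u x.
Proof.
move=> ws es ex; have [s1 [s2 [-> w1 w2]]] := walk_split ws es ex.
by exists s1 => // d /=; rewrite mem_cat => ->.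
Qed.

Lemma reach_split u s v x : walk u s v -> reach [set` s] u x ->
  exists s1 s2, [/\ s = s1 ++ s2, walk u s1 x & walk x s2 v].
Proof.
move=> ws r; pose P y := y = u \/ exists2 e, e \in s & incident e y.
have : P x.
  apply: (reach_ind (P := P) _ r); last by left.
  by move=> e y z es eyz _; right; exists e => //; apply: joins_incidentr eyz.
by case=> [->|[e es ex]]; [exists [::], s|apply: walk_split ex].
Qed.

Lemma first_exit S (F : set E) v y g : reach S v y -> S g -> ~ F g ->
  incident g y ->
  exists x h, [/\ S h, ~ F h, incident h x & reach (S `&` F) v x].
Proof.
move=> [s]; elim: s v => [|e s IH] v /=.
  by move=> <- _ Sg Fg gv; exists v, g; split=> //; apply: reach_refl.
move=> [w evw ws] sS Sg Fg gy; have Se : S e by apply: sS; rewrite inE eqxx.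
have [Fe|nFe] := pselect (F e); last first.
  exists v, e; split=> //; last exact: reach_refl.
  exact: joins_incidentl evw.
have [|x [h [Sh Fh hx r]]] := IH w ws _ Sg Fg gy.
  by move=> d ds; apply: sS; rewrite inE ds orbT.
exists x, h; split=> //; apply: reach_trans r.
by apply: reach_joins evw; split.
Qed.

(** The prescribed edge [e] is kept for the end: the walk is stopped as soon as
it meets an endpoint of [e], so that removing its repetitions does not interfere
with [e]. *)
Lemma trail_through S b e z : S e -> incident e z -> reach S b z ->
  exists p w, [/\ walk b p w, uniq p, e \in p & forall d, d \in p -> S d].
Proof.
move=> Se ez rz.
have [z' ez' [q0 wq0 q0S]] :
    exists2 z', incident e z' & reach (S `\` [set` [:: e]]) b z'.
  have [eb|neb] := pselect (incident e b).
    by exists b => //; apply: reach_refl.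
  case: rz => q; elim: q b neb => [|d q IH] b neb /=.
    by move=> bz; case: neb; rewrite bz.
  move=> [c bdc wq] qS; have Sd : S d by apply: qS; rewrite inE eqxx.
  have de : d <> e.
    by move=> de; apply: neb; rewrite -de; apply: joins_incidentl bdc.
  have rc : reach (S `\` [set` [:: e]]) b c.
    by apply: reach_joins bdc; split=> //=; rewrite inE => /eqP.
  have [ec|nec] := pselect (incident e c); first by exists c.
  have [||z' ez' r] := IH c nec => //.
    by move=> x xq; apply: qS; rewrite inE xq orbT.
  by exists z' => //; apply: reach_trans r.
have [q [uq wq sub]] := walk_uniq wq0.
have [w ezw] := incident_joins ez'.
have eq : e \notin q by apply/negP => /sub/q0S[_] /=; rewrite inE eqxx.
exists (q ++ [:: e]), w; split.
- by apply/walk_cat; exists z' => //; apply/walk1.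
- by rewrite uniq_catC /= eq.
- by rewrite mem_cat inE eqxx orbT.
- by move=> d; rewrite mem_cat inE => /orP[/sub/q0S[]|/eqP->].
Qed.

Definition comp_edges S z : set E :=
  [set e | S e /\ exists2 y, incident e y & reach S z y].

Definition no_finite_comp S :=
  forall e z, S e -> incident e z -> ~ finite_set (comp_edges S z).

Lemma sub_comp S z z' : reach S z' z -> comp_edges S z `<=` comp_edges S z'.
Proof.
by move=> r e [Se [y ey r']]; split=> //; exists y => //; apply: reach_trans r'.
Qed.

(** The component of [z] survives a change of the edge set as long as none of
its own edges is lost; membership in [S'] may be checked while walking. *)
Lemma comp_restrict S S' z :
  (forall d y, S d -> incident d y -> reach S z y -> reach S' z y -> S' d) ->
  (forall y, reach S z y -> reach S' z y) /\
  comp_edges S z `<=` comp_edges S' z.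
Proof.
move=> SS'; have rz y : reach S z y -> reach S' z y.
  move=> r; pose P y := reach S' z y /\ reach S z y.
  suff [] : P y by [].
  apply: (reach_ind (P := P) _ r); last by split; apply: reach_refl.
  move=> d y1 y2 Sd dy [r1 r2]; split; last first.
    exact: reach_trans r2 (reach_joins Sd dy).
  have S'd := SS' _ _ Sd (joins_incidentl dy) r2 r1.
  exact: reach_trans r1 (reach_joins S'd dy).
split=> // d [Sd [y dy r]]; split; last by exists y => //; apply: rz.
by apply: (SS' _ y) => //; apply: rz.
Qed.

Lemma finite_comp_bigcup S (s : seq V) :
  finite_set [set e | exists2 y, y \in s &
    finite_set (comp_edges S y) /\ comp_edges S y e].
Proof.
rewrite (_ : mkset _ =
  \bigcup_(y in [set y | y \in s /\ finite_set (comp_edges S y)])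
    comp_edges S y).
  apply: bigcup_finite; last by move=> y [].
  by apply: sub_finite_set (finite_seq s) => y [].
apply/seteqP; split=> e; first by move=> [y ys [fy ye]]; exists y.
by move=> [y [ys fy] ye]; exists y.
Qed.

Lemma setD_cat S p s :
  (S `\` [set` p]) `\` [set` s] = S `\` [set` p ++ s].
Proof.
apply/seteqP; split=> e /=; rewrite mem_cat.
  by move=> [[Se np] ns]; split=> // /orP[].
by move=> [Se nps]; split; first split=> //; move=> eP; apply: nps;
  rewrite eP ?orbT.
Qed.

(** A trail [p] cuts off finite components from [S]; adding all of their edges
[K] to [p] repairs this.  Each edge of [K] is connected to [p] inside [K], as
otherwise its component would already be finite in [S].  Hence [K] is contained
in finitely many finite components, one for each vertex of [p]. *)
Lemma absorb_finite_components S v p w e0 :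
  walk v p w -> (forall e, e \in p -> S e) ->
  no_finite_comp S -> S e0 -> incident e0 v ->
  exists K : seq E,
  [/\ uniq K /\ (forall e, e \in K -> S e /\ e \notin p),
      forall e z d, e \in K -> incident e z -> S d -> incident d z ->
        d \in p ++ K,
      forall e z, e \in K -> incident e z -> reach [set` p ++ K] v z,
      no_finite_comp (S `\` [set` p ++ K]) &
      exists x g, [/\ (S `\` [set` p ++ K]) g, incident g x &
                      reach [set` p ++ K] v x]].
Proof.
move=> wp pS nS Se0 e0v; set S1 := S `\` [set` p].
pose Kset : set E := [set e | S1 e /\
  exists2 z, incident e z & finite_set (comp_edges S1 z)].
have Kfin e z : Kset e -> incident e z -> finite_set (comp_edges S1 z).
  move=> [S1e [z' ez' f]] ez; apply: sub_finite_set f; apply: sub_comp.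
  exact: reach_edge ez' ez.
have reachK z y : finite_set (comp_edges S1 z) -> reach S1 z y ->
    reach Kset z y.
  move=> fz; have [|rz _] := @comp_restrict S1 Kset z; last exact: rz.
  move=> d y' S1d dy' r _; split=> //; exists y' => //.
  exact: sub_finite_set (sub_comp r) fz.
pose end1 e : V := (ends (e : edge G)).1.
pose end2 e : V := (ends (e : edge G)).2.
pose verts : seq V := v :: flatten [seq [:: end1 e; end2 e] | e <- p].
have vertsP e y : e \in p -> incident e y -> y \in verts.
  move=> ep ey; rewrite inE; apply/orP; right; apply/flattenP.
  exists [:: end1 e; end2 e]; first by apply/mapP; exists e.
  by rewrite !inE /end1 /end2; case: ey => ->; rewrite eqxx ?orbT.
have vertsR y : y \in verts -> reach [set` p] v y.
  rewrite inE => /predU1P[->|/flattenP[l /mapP[e ep ->]]].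
    exact: reach_refl.
  by rewrite !inE => /orP[] /eqP ->; apply: walk_reach wp ep _; [left|right].
have touch e z : Kset e -> incident e z ->
    exists2 y, y \in verts & reach S1 z y.
  move=> Ke ez; apply: contrapT => nt.
  have [|_ sub] := @comp_restrict S S1 z.
    move=> d y Sd dy _ r; split=> // dp.
    by apply: nt; exists y => //; apply: vertsP dp dy.
  apply: (nS e z _ ez); first by case: Ke => -[].
  exact: sub_finite_set sub (Kfin _ _ Ke ez).
have finK : finite_set Kset.
  apply: sub_finite_set (finite_comp_bigcup S1 verts) => e Ke.
  have ez := incident_fst e; have [y yv r] := touch _ _ Ke ez.
  exists y => //; split.
    by apply: sub_finite_set (Kfin _ _ Ke ez); apply: sub_comp.
  case: Ke => S1e _; split=> //.
  by exists (ends (e : edge G)).1 => //; apply: reach_sym.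
have [K0 KE] := (finite_seqP _).1 finK.
pose K := undup K0.
have KP e : e \in K <-> Kset e by rewrite mem_undup KE.
have subK : Kset `<=` [set` p ++ K].
  by move=> e /KP eK /=; rewrite mem_cat eK orbT.
have subp : [set` p] `<=` [set` p ++ K].
  by move=> e /= ep; rewrite mem_cat ep.
(* an infinite component of [S1] contains no edge of [K] *)
have nD : no_finite_comp (S `\` [set` p ++ K]).
  rewrite -setD_cat -/S1 => e z [S1e neK] ez fz.
  have [|_ sub] := @comp_restrict S1 (S1 `\` [set` K]) z.
    move=> d y S1d dy r _; split=> // /KP Kd.
    apply: neK; apply/KP; split=> //; exists z => //.
    apply: sub_finite_set (Kfin _ _ Kd dy).
    by apply: sub_comp; apply: reach_sym.
  apply: neK; apply/KP; split=> //; exists z => //.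
  exact: sub_finite_set sub fz.
exists K; split=> //.
- split; first exact: undup_uniq.
  by move=> e /KP[[Se /negP ep] _].
- move=> e z d /KP Ke ez Sd dz; have [dp|dp] := boolP (d \in p).
    by rewrite mem_cat dp.
  apply: subK; split; first by split=> //; apply/negP.
  by exists z => //; apply: Kfin ez.
- move=> e z /KP Ke ez; have [y yv r] := touch _ _ Ke ez.
  apply: reach_trans (sub_reach subp (vertsR _ yv)) _.
  by apply/reach_sym/(sub_reach subK)/reachK => //; apply: Kfin ez.
- have [g0 [Sg0 [y g0y ry]] ng0] :
      exists2 g0, comp_edges S v g0 & ~ [set` p ++ K] g0.
    apply: contrapT => nex; apply: (nS _ _ Se0 e0v).
    apply: sub_finite_set (finite_seq (p ++ K)) => d vd.
    by apply: contrapT => nd; apply: nex; exists d.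
  have [x [h [Sh nh hx r]]] := first_exit ry Sg0 ng0 g0y.
  by exists x, h; split=> //; apply: sub_reach r => d [].
Qed.

Lemma isolated_edge S g x y : joins g x y ->
  (forall d, S d -> incident d x \/ incident d y -> d = g) ->
  finite_set (comp_edges S x).
Proof.
move=> gxy iso; apply: sub_finite_set (finite_set1 g) => d [Sd [z dz r]].
suff zE : z = x \/ z = y by apply: iso => //; case: zE => <-; [left|right].
apply: (reach_ind (P := fun z => z = x \/ z = y) _ r); last by left.
move=> c z1 z2 Sc cz z1E; have cg : c = g.
  apply: iso => //; move: (joins_incidentl cz).
  by case: z1E => <- ; [left|right].
by apply: joins_incident gxy _; rewrite -cg; apply: joins_incidentr cz.
Qed.

Lemma distinct_edges S x y g h : no_finite_comp S -> x <> y ->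
  S g -> incident g x -> S h -> incident h y ->
  exists g' h', [/\ g' <> h', S g', incident g' x, S h' & incident h' y].
Proof.
move=> nS xy Sg gx Sh hy; have [gh|gh] := pselect (g = h); last by exists g, h.
subst h; apply: contrapT => nex; apply: (nS g x Sg gx).
have gxy : joins g x y.
  have [w gxw] := incident_joins gx.
  by case: (joins_incident gxw hy) => [/esym //|->].
apply: (isolated_edge gxy) => d Sd dxy; apply: contrapT => dg; apply: nex.
by case: dxy => dI; [exists d, g|exists g, d]; split=> // /esym.
Qed.

End Walks.

(** * Parities and finite Eulerian trails *)

Section Parity.
Variable G : graph.
Local Notation V := {classic (vertex G)}.
Local Notation E := {classic (edge G)}.
Implicit Types (u v w x y z a b : V) (e d g h : E) (p q s R : seq E).

(** The parity of the degree of [x] in the graph with edges [s]; the two ends of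
a loop cancel. *)
Definition parity s x : bool :=
  \big[addb/false]_(e <- s)
    (((ends (e : edge G)).1 == x :> V) (+) ((ends (e : edge G)).2 == x :> V)).

Lemma parity_nil x : parity [::] x = false.
Proof. by rewrite /parity big_nil. Qed.

Lemma parity_cat s1 s2 x : parity (s1 ++ s2) x = parity s1 x (+) parity s2 x.
Proof. by rewrite /parity big_cat. Qed.

Lemma parity_perm s1 s2 x : perm_eq s1 s2 -> parity s1 x = parity s2 x.
Proof. by move=> ps; rewrite /parity (perm_big _ ps). Qed.

Lemma parity_joins e u v x :
  joins e u v -> parity [:: e] x = (u == x) (+) (v == x).
Proof. by rewrite /parity big_seq1 => -[]-> //=; rewrite addbC. Qed.

Lemma parity_cons e s x : parity (e :: s) x = parity [:: e] x (+) parity s x.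
Proof. by rewrite -cat1s parity_cat. Qed.

Lemma parity_walk u s v x : walk u s v -> parity s x = (u == x) (+) (v == x).
Proof.
elim: s u => [|e s IH] u /=; first by move=> ->; rewrite parity_nil addbb.
move=> [w euw ws]; rewrite parity_cons (parity_joins _ euw) (IH _ ws).
by rewrite -!addbA (addbA _ _ (v == x)) addbb.
Qed.

Lemma parity_out s x :
  (forall e, e \in s -> ~ incident e x) -> parity s x = false.
Proof.
elim: s => [|e s IH] es; first exact: parity_nil.
rewrite parity_cons IH; last by move=> d ds; apply: es; rewrite inE ds orbT.
have := es e; rewrite inE eqxx => /(_ isT).
rewrite /parity big_seq1 /incident => /not_orP[n1 n2].
have /negbTE-> : (ends (e : edge G)).1 != x :> V by apply/eqP.
by have /negbTE-> : (ends (e : edge G)).2 != x :> V by apply/eqP.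
Qed.

Lemma parity_true s x : parity s x -> exists2 e, e \in s & incident e x.
Proof.
move=> sx; apply: contrapT => ne.
by move: sx; rewrite parity_out // => e es ex; apply: ne; exists e.
Qed.

(** Walk from [a] along unused edges for as long as possible.  Using an edge
moves the odd vertex from [a] to its other end, so the walk can only be stuck at
[b].  For [a = b] the second part gives nonempty closed trails. *)
Lemma trail_between_odd a b R : uniq R ->
  (forall x, parity R x = (a == x) (+) (b == x)) ->
  (exists s, [/\ uniq s, {subset s <= R} & walk a s b]) /\
  (forall e, e \in R -> incident e a ->
    exists s, [/\ uniq s, s != [::], {subset s <= R} & walk a s b]).
Proof.
move: {2}(size R) (erefl (size R)) => n; elim: n a R => [|n IH] a R szR uR parR.
  have R0 : R = [::] by case: R szR {uR parR}.
  split; last by rewrite R0.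
  exists [::]; split=> //=; move: (parR b); rewrite R0 parity_nil eqxx addbT.
  by case: eqP.
have stp e : e \in R -> incident e a ->
    exists s, [/\ uniq s, s != [::], {subset s <= R} & walk a s b].
  move=> eR /incident_joins[w eaw].
  have peR := perm_to_rem eR.
  have [|||[s [us sR ws]] _] := IH w (rem e R).
  - by rewrite size_rem // szR.
  - exact: rem_uniq.
  - move=> x; move: (parR x).
    rewrite (parity_perm _ peR) parity_cons (parity_joins _ eaw).
    by move: (parity _ _) (a == x) (b == x) (w == x); do 4 case.
  exists (e :: s); split=> //=.
  - rewrite us andbT; apply/negP => /sR.
    by rewrite mem_rem_uniqF.
  - move=> d; rewrite inE => /predU1P[->//|/sR]; exact: mem_rem.
  - by exists w.
split; last exact: stp.
have [aR|] := pselect (exists2 e, e \in R & incident e a).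
  by case: aR => e eR ea; have [s [? _ ? ?]] := stp e eR ea; exists s.
move=> naR; exists [::]; split=> //=.
have : parity R a = false.
  by apply: parity_out => e eR ea; apply: naR; exists e.
by rewrite parR eqxx addTb => /negbFE/eqP.
Qed.

(** Hierholzer's argument: as long as edges are left, one of them touches the
trail, and a closed trail through the remaining edges can be inserted there. *)
Lemma insert_closed_trails a b s R : walk a s b -> uniq (s ++ R) ->
  (forall x, parity R x = false) ->
  (forall e x, e \in R -> incident e x -> reach [set` s ++ R] a x) ->
  exists2 s', walk a s' b & perm_eq s' (s ++ R).
Proof.
move: {2}(size R) (leqnn (size R)) => n.
elim: n s R => [|n IH] s R szR ws usR par0 conn.
  have R0 : R = [::] by case: R szR {usR par0 conn}.
  by exists s => //; rewrite R0 cats0.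
have [R0|[e0 e0R]] : R = [::] \/ exists e, e \in R.
    case: R {szR usR par0 conn} => [|e R]; first by left.
    by right; exists e; rewrite inE eqxx.
  by exists s => //; rewrite R0 cats0.
have [us [dis uR]] : uniq s /\ (forall e, e \in R -> e \notin s) /\ uniq R.
  by move: usR; rewrite cat_uniq => /and3P[-> /hasPn dis ->].
have e0y := incident_fst e0.
have [||x [h [hsR hs hx rx]]] :=
    first_exit (F := [set` s]) (conn _ _ e0R e0y) _ _ e0y.
- by rewrite /= mem_cat e0R orbT.
- by apply/negP; apply: dis.
have hR : h \in R by move: hsR; rewrite /= mem_cat => /orP[].
have [|_ /(_ h hR hx) [c [uc cN cR wc]]] := @trail_between_odd x x R uR.
  by move=> z; rewrite par0 addbb.
have {}rx : reach [set` s] a x by apply: sub_reach rx => d [].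
have [s1 [s2 [sE w1 w2]]] := reach_split ws rx.
have [R' pR] : exists R', perm_eq (c ++ R') R.
  by exists [seq d <- R | d \notin c]; apply: perm_cat_filterN.
have pE : perm_eq ((s1 ++ c ++ s2) ++ R') (s ++ R).
  by rewrite sE -!catA perm_cat2l perm_catCA perm_cat2l.
have [|||||s' ws' ps'] := IH (s1 ++ c ++ s2) R'.
- have szE := perm_size pR; rewrite size_cat in szE.
  have c0 : 0 < size c by rewrite lt0n size_eq0.
  by rewrite -ltnS (leq_trans _ szR) // -szE -[X in X < _]add0n ltn_add2r.
- by apply/walk_cat; exists x => //; apply/walk_cat; exists x.
- by rewrite (perm_uniq pE).
- move=> z; rewrite -(par0 z) -(parity_perm _ pR) parity_cat.
  by rewrite (parity_walk _ wc) addbb.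
- move=> e z eR' ez; have -> : [set` (s1 ++ c ++ s2) ++ R'] = [set` s ++ R].
    by apply/seteqP; split=> d /=; rewrite (perm_mem pE).
  by apply: conn ez; rewrite -(perm_mem pR) mem_cat eR' orbT.
by exists s' => //; apply: perm_trans ps' pE.
Qed.

Lemma eulerian_trail a b R : uniq R ->
  (forall x, parity R x = (a == x) (+) (b == x)) ->
  (forall e x, e \in R -> incident e x -> reach [set` R] a x) ->
  exists2 s, walk a s b & perm_eq s R.
Proof.
move=> uR parR conn; have [[s [us sR ws]] _] := trail_between_odd uR parR.
set R' := [seq d <- R | d \notin s].
have pR : perm_eq (s ++ R') R by apply: perm_cat_filterN.
have [|||s' ws' ps'] := @insert_closed_trails a b s R' ws.
- by rewrite (perm_uniq pR).
- move=> x; move: (parR x).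
  rewrite -(parity_perm _ pR) parity_cat (parity_walk _ ws).
  by move: (parity _ _) (a == x) (b == x); do 3 case.
- move=> e z; rewrite mem_filter => /andP[_ eR] ez.
  have -> : [set` s ++ R'] = [set` R].
    by apply/seteqP; split=> d /=; rewrite (perm_mem pR).
  exact: conn ez.
by exists s' => //; apply: perm_trans ps' pR.
Qed.

(** Removing an edge at the odd vertex makes its other end the only odd vertex,
so the process would never stop. *)
Lemma no_single_odd_vertex w s : ~ (forall x, parity s x = (w == x)).
Proof.
move: {2}(size s) (erefl (size s)) => n; elim: n w s => [|n IH] w s szs pars.
  by case: s szs pars => // _ /(_ w); rewrite parity_nil eqxx.
have [|e es ew] := @parity_true s w; first by rewrite pars.
have [v ewv] := incident_joins ew.
apply: (IH v (rem e s)); first by rewrite size_rem // szs.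
move=> x; have := pars x.
rewrite (parity_perm _ (perm_to_rem es)) parity_cons (parity_joins _ ewv).
by move: (parity _ _) (w == x) (v == x); do 3 case.
Qed.

End Parity.

(** * Extending a trail *)

Section Extension.
Variable G : graph.
Local Notation V := {classic (vertex G)}.
Local Notation E := {classic (edge G)}.
Implicit Types (u v w x y z a b : V) (e d g h : E) (p q s R B F : seq E).
Implicit Type S : set E.

(** The next three properties are what the construction uses of the property
[E_2], in terms of lists of edges.  A list containing every edge at [x] exists
only when [x] has finite degree. *)
Definition finite_degrees_even := forall x (L : seq E), uniq L ->
  (forall e, incident e x -> e \in L) -> parity L x = false.

Definition at_most_two_ends := forall s z1 z2 z3, let S := ~` [set` s] in
  ~ finite_set (comp_edges S z1) -> ~ finite_set (comp_edges S z2) ->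
  ~ finite_set (comp_edges S z3) ->
  [\/ reach S z1 z2, reach S z1 z3 | reach S z2 z3].

Definition even_removal_one_end := forall s z1 z2, uniq s ->
  (forall x, parity s x = false) -> let S := ~` [set` s] in
  ~ finite_set (comp_edges S z1) -> ~ finite_set (comp_edges S z2) ->
  reach S z1 z2.

Hypotheses (deg_even : finite_degrees_even) (two_ends : at_most_two_ends).
Hypothesis (one_end : even_removal_one_end).

(** If [g] were the only remaining edge at [x], it would be a loop forming a
finite component, or [x] would have finite odd degree. *)
Lemma distinct_edges_closed s x g : uniq s -> no_finite_comp (~` [set` s]) ->
  parity s x = false -> g \notin s -> incident g x ->
  exists h, [/\ g <> h, h \notin s & incident h x].
Proof.
move=> us nS ps gs gx; apply: contrapT => nex.
have all_g d : d \notin s -> incident d x -> d = g.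
  move=> ds dx; apply: contrapT => dg.
  by apply: nex; exists d; split=> // /esym.
have [w gxw] := incident_joins gx.
have [wx|wx] := eqVneq w x.
  apply: (nS g x _ gx); first exact/negP.
  rewrite wx in gxw; apply: (isolated_edge gxw) => d /negP ds dx.
  by apply: all_g => //; case: dx.
have : parity (g :: s) x = false.
  apply: deg_even => [|d dx]; first by rewrite /= gs us.
  rewrite inE; have [ds|ds] := boolP (d \in s); first by rewrite orbT.
  by rewrite (all_g d) ?eqxx.
by rewrite parity_cons (parity_joins _ gxw) ps eqxx (negbTE wx).
Qed.

(** A trail is stored as two trails [B] and [F] from a common vertex [u] inside
it, going backward to the initial vertex [a] and forward to the final vertex
[b].  Lengthening either end is then appending to a list, and exchanging [B] and
[F] reverses the trail. *)
Record extendable u B F a b : Prop := Extendable {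
  extendable_backward : walk u B a;
  extendable_forward : walk u F b;
  extendable_uniq : uniq (B ++ F);
  extendable_comp : no_finite_comp (~` [set` B ++ F]);
  extendable_ends : exists e f, [/\ e <> f,
    e \notin B ++ F, incident e b, f \notin B ++ F & incident f a] }.

Lemma extendable_sym u B F a b : extendable u B F a b -> extendable u F B b a.
Proof.
case=> wB wF uBF nBF [e [f [ef eN eb fN fa]]].
have pE : B ++ F =i F ++ B by move=> d; rewrite !mem_cat orbC.
split=> //; first by rewrite uniq_catC.
  have -> // : [set` F ++ B] = [set` B ++ F].
  by apply/seteqP; split=> d /=; rewrite pE.
by exists f, e; rewrite -!pE; split=> // /esym.
Qed.

Lemma extendable_parity u B F a b x : extendable u B F a b ->
  parity (B ++ F) x = (a == x) (+) (b == x).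
Proof.
case=> wB wF _ _ _; rewrite parity_cat (parity_walk _ wB) (parity_walk _ wF).
by move: (u == x) (a == x) (b == x); do 3 case.
Qed.

(** If [a] and [b] are not connected by unvisited edges, a third component would
contradict the bound on the ends.  Otherwise close the trail by an unvisited
trail [q] from [b] to [a].  All degrees in what is removed are now even, so one
infinite component remains; but the component of [e], which [q] does not touch,
and an infinite part of the component of [b] both remain. *)
Lemma unvisited_reachable u B F a b e z :
  extendable u B F a b -> e \notin B ++ F -> incident e z ->
  reach (~` [set` B ++ F]) a z \/ reach (~` [set` B ++ F]) b z.
Proof.
move=> ext; have parE x := extendable_parity x ext.
case: ext => wB wF us nS [eb [ea [_ ebS ebb eaS eaa]]] eS ez.
move: (B ++ F) => s in us nS ebS eaS eS parE *.
set S := ~` [set` s] in nS *.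
have nin d : d \notin s -> S d by move/negP.
have [rba|nrba] := pselect (reach S b a); last first.
  have [] := @two_ends s z a b; first exact: nS (nin _ eS) ez.
  - exact: nS (nin _ eaS) eaa.
  - exact: nS (nin _ ebS) ebb.
  - by left; apply: reach_sym.
  - by right; apply: reach_sym.
  - by move/reach_sym.
right; apply: contrapT => nrbz.
have [q [uq wq qS]] :
    exists q, [/\ uniq q, walk b q a & forall d, d \in q -> S d].
  have [q' wq' q'S] := rba; have [q [uq wq sub]] := walk_uniq wq'.
  by exists q; split=> // d /sub/q'S.
have [K [[_ KS] _ _ nD [x [g [Dg gx rx]]]]] :=
  absorb_finite_components wq qS nS (nin _ ebS) ebb.
have rbx : reach S b x.
  apply: sub_reach rx => d /=; rewrite mem_cat => /orP[/qS//|/KS[]//].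
have SqE : ~` [set` s ++ q] = S `\` [set` q].
  by rewrite /S -!setTD setD_cat.
have Sq : S `\` [set` q] `<=` S by move=> d [].
apply nrbz; apply: reach_trans rbx (sub_reach Sq _); rewrite -SqE.
apply: one_end.
- rewrite cat_uniq us uq andbT; apply/hasPn => d /qS.
  by move/negP.
- move=> y; rewrite parity_cat parE (parity_walk _ wq).
  by move: (a == y) (b == y); do 2 case.
- rewrite SqE => fx; apply: (nD _ _ Dg gx); rewrite -setD_cat.
  apply: sub_finite_set fx => d [[Sd _] [y dy r]]; split=> //; exists y => //.
  by apply: sub_reach r => c [].
- rewrite SqE => fz; apply: (nS e z (nin _ eS) ez).
  have [|_ sub] := @comp_restrict _ S (S `\` [set` q]) z.
    move=> d y Sd dy r _; split=> // dq; apply: nrbz.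
    apply: reach_trans (reach_sym r).
    exact: sub_reach qS (walk_reach wq dq dy).
  exact: sub_finite_set sub fz.
Qed.

(** The step described at the beginning, with its two cases.  When the trail is
cut at [x = b] the forward end does not move; this happens only if the trail was
not closed and becomes closed. *)
Lemma extend_through u B F a b e z :
  extendable u B F a b -> e \notin B ++ F ->
  incident e z -> reach (~` [set` B ++ F]) b z ->
  exists B1 F1 a' b', [/\ extendable u (B ++ B1) (F ++ F1) a' b',
    e \in B1 ++ F1 & F1 != [::] \/ (a <> b /\ a' = b')].
Proof.
move=> ext eS ez rz; have parE x := extendable_parity x ext.
case: ext => wB wF us nS [eb [ea [_ ebS ebb eaS eaa]]].
set s := B ++ F in us nS ebS eaS eS parE rz; set S := ~` [set` s] in nS rz.
have nin d : d \notin s -> S d by move/negP.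
have [p [w [wp up ep pS]]] := trail_through (nin _ eS) ez rz.
have [K [[uK KS] Kc Kr nD [x [g [Dg gx rx]]]]] :=
  absorb_finite_components wp pS nS (nin _ ebS) ebb.
set R := p ++ K in Kc Kr nD Dg rx.
have RS d : d \in R -> d \notin s.
  by rewrite mem_cat => /orP[/pS|/KS[]] /negP.
have uR : uniq R.
  by rewrite cat_uniq up uK andbT; apply/hasPn => d /KS[].
have usR : uniq (s ++ R).
  by rewrite cat_uniq us uR andbT; apply/hasPn => d /RS.
have SR t : perm_eq t (s ++ R) -> ~` [set` t] = S `\` [set` R].
  move=> pt; rewrite /S -!setTD setD_cat.
  by congr (_ `\` _); apply/seteqP; split=> d /=; rewrite (perm_mem pt).
have psp y : parity (s ++ p) y = (a == y) (+) (w == y).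
  rewrite parity_cat parE (parity_walk _ wp).
  by move: (a == y) (b == y) (w == y); do 3 case.
(* at a vertex of [K] all edges are in [s], [p] or [K], so parities add to 0 *)
have Kall y : parity K y -> parity K y = (a == y) (+) (w == y).
  move=> Ky; rewrite -psp; have [d dK dy] := parity_true Ky.
  have : parity ((s ++ p) ++ K) y = false.
    apply: deg_even; first by rewrite -catA.
    move=> c cy; rewrite -catA mem_cat; case: (boolP (c \in s)) => //= cs.
    exact: Kc dK dy (nin _ cs) cy.
  by rewrite parity_cat Ky; case: (parity _ _).
have eR : e \in R by rewrite mem_cat ep.
have Rreach d y : d \in R -> incident d y -> reach [set` R] b y.
  rewrite mem_cat => /orP[dp|dK] dy; last exact: Kr dK dy.
  by apply: sub_reach (walk_reach wp dp dy) => c /= cp; rewrite mem_cat cp.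
have [closing|[wa par0]] : (forall y, parity K y = (a == y) (+) (w == y)) \/
    (w <> a /\ forall y, parity K y = false).
  have [wa|wa] := eqVneq w a.
    left=> y; have := Kall y; rewrite wa addbb.
    by case: (parity K y) => // ->.
  have out y : a != y -> w != y -> parity K y = false.
    move=> ay wy; have := Kall y; rewrite (negbTE ay) (negbTE wy).
    by case: (parity K y) => // ->.
  have spl (P : V -> Prop) :
      P a -> P w -> (forall y, a != y -> w != y -> P y) -> forall y, P y.
    move=> Pa Pw Po y; have [<- //|ay] := eqVneq a y.
    by have [<- //|wy] := eqVneq w y; apply: Po.
  case Ka: (parity K a); case Kw: (parity K w).
  - left; apply: spl => [||y ay wy].
    + by rewrite Ka eqxx (negbTE wa).
    + by rewrite Kw eqxx eq_sym (negbTE wa).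
    + by rewrite out // (negbTE ay) (negbTE wy).
  - case: (@no_single_odd_vertex G a K); apply: spl => [||y ay wy].
    + by rewrite Ka eqxx.
    + by rewrite Kw eq_sym (negbTE wa).
    + by rewrite out // (negbTE ay).
  - case: (@no_single_odd_vertex G w K); apply: spl => [||y ay wy].
    + by rewrite Ka (negbTE wa).
    + by rewrite Kw eqxx.
    + by rewrite out // (negbTE wy).
  - by right; split; [apply/eqP|apply: spl].
- have [|c wc pc] := @eulerian_trail _ b a R uR _ Rreach.
    move=> y; rewrite parity_cat (parity_walk _ wp) closing.
    by move: (a == y) (b == y) (w == y); do 3 case.
  have {}rx : reach [set` c] b x.
    by apply: sub_reach rx => d /=; rewrite (perm_mem pc).
  have [c1 [c2 [cE w1 w2 ne]]] : exists c1 c2, [/\ c = c1 ++ c2, walk b c1 x,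
      walk x c2 a & c1 != [::] \/ a <> b].
    (* if [x = a], nothing has to be put backward *)
    have [xa|xa] := pselect (x = a).
      exists c, [::]; split=> //; [by rewrite cats0|by rewrite xa|left].
      by apply/eqP => c0; move: eR; rewrite -(perm_mem pc) c0.
    have [c1 [c2 [cE w1 w2]]] := reach_split wc rx.
    exists c1, c2; split=> //; case: c1 {cE} w1 => [|? ?]; last by left.
    by move=> /= bx; right=> ab; apply: xa; rewrite -bx ab.
  exists (rev c2), c1, x, x.
  have pE : perm_eq ((B ++ rev c2) ++ F ++ c1) (s ++ R).
    rewrite -(perm_cat2l s) in pc; apply: perm_trans pc.
    rewrite cE /s -!catA perm_cat2l.
    by rewrite perm_catC -!catA !perm_cat2l perm_rev.
  have uE : uniq ((B ++ rev c2) ++ F ++ c1) by rewrite (perm_uniq pE).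
  have nE : no_finite_comp (~` [set` (B ++ rev c2) ++ F ++ c1]).
    by rewrite (SR _ pE).
  have wB' : walk u (B ++ rev c2) x.
    by apply/walk_cat; exists a => //; apply: walk_rev.
  have wF' : walk u (F ++ c1) x by apply/walk_cat; exists b.
  have gE : g \notin (B ++ rev c2) ++ F ++ c1.
    by rewrite (perm_mem pE) mem_cat negb_or; case: Dg => /negP -> /negP ->.
  split.
  + split=> //.
    have [|h [gh hE hx]] := distinct_edges_closed uE nE _ gE gx.
      rewrite parity_cat (parity_walk _ wB') (parity_walk _ wF').
      by move: (u == x) (x == x); do 2 case.
    by exists g, h.
  + by rewrite mem_cat mem_rev orbC -mem_cat -cE (perm_mem pc).
  + by case: ne => ?; [left|right].
- have [|c wc pc] := @eulerian_trail _ b w R uR _ Rreach.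
    by move=> y; rewrite parity_cat (parity_walk _ wp) par0 addbF.
  exists [::], c, a, w.
  have pE : perm_eq ((B ++ [::]) ++ F ++ c) (s ++ R).
    by rewrite cats0 catA perm_cat2l.
  have uE : uniq ((B ++ [::]) ++ F ++ c) by rewrite (perm_uniq pE).
  have nE : no_finite_comp (~` [set` (B ++ [::]) ++ F ++ c]).
    by rewrite (SR _ pE).
  have left_edge y : (a == y) (+) (w == y) ->
      exists2 d, (~` [set` (B ++ [::]) ++ F ++ c]) d & incident d y.
    move=> odd_y; apply: contrapT => nex.
    have : parity ((s ++ p) ++ K) y = false.
      apply: deg_even => [|d dy]; first by rewrite -catA.
      rewrite -catA -(perm_mem pE); apply: contrapT => nd; apply: nex.
      by exists d.
    by rewrite parity_cat psp par0 addbF odd_y.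
  have wa' : w != a by apply/eqP.
  have [|g1 g1S g1w] := left_edge w; first by rewrite eqxx eq_sym (negbTE wa').
  have [|g2 g2S g2a] := left_edge a; first by rewrite eqxx (negbTE wa').
  have [h1 [h2 [h12 h1S h1w h2S h2a]]] := distinct_edges nE wa g1S g1w g2S g2a.
  split.
  + split=> //; first by rewrite cats0.
      by apply/walk_cat; exists b.
    by exists h1, h2; split=> //; apply/negP.
  + by rewrite /= (perm_mem pc).
  + by left; apply/eqP => c0; move: eR; rewrite -(perm_mem pc) c0.
Qed.

(** If one step through an edge at [b] does not move the forward end, the trail
has become closed, and a second step moves it. *)
Lemma extend_end u B F a b : extendable u B F a b ->
  exists B1 F1 a' b', extendable u (B ++ B1) (F ++ F1) a' b' /\ F1 != [::].
Proof.
move=> ext; have [e [_ [_ eS eb _ _]]] := extendable_ends ext.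
have [B1 [F1 [a1 [b1 [ext1 _ alt]]]]] :=
  extend_through ext eS eb (reach_refl _ _).
case: alt => [F1N|[_ ab1]]; first by exists B1, F1, a1, b1.
have [e1 [_ [_ e1S e1b _ _]]] := extendable_ends ext1.
have [B2 [F2 [a2 [b2 [ext2 _ alt]]]]] :=
  extend_through ext1 e1S e1b (reach_refl _ _).
case: alt => [F2N|[]//].
exists (B1 ++ B2), (F1 ++ F2), a2, b2; rewrite !catA; split=> //.
by case: F1 {ext1 ext2 e1S} => //; case: F2 F2N.
Qed.

Lemma extend_both_sides u B F a b e : extendable u B F a b ->
  exists B1 F1 a' b', [/\ extendable u (B ++ B1) (F ++ F1) a' b', B1 != [::],
    F1 != [::] & e \in (B ++ B1) ++ (F ++ F1)].
Proof.
move=> ext.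
have [B1 [F1 [a1 [b1 [ext1 e1]]]]] : exists B1 F1 a' b',
    extendable u (B ++ B1) (F ++ F1) a' b' /\ e \in (B ++ B1) ++ (F ++ F1).
  have [eS|eS] := boolP (e \in B ++ F).
    by exists [::], [::], a, b; rewrite !cats0.
  have ez := incident_fst e.
  case: (unvisited_reachable ext eS ez) => r.
    have eS' : e \notin F ++ B by rewrite mem_cat orbC -mem_cat.
    have r' : reach (~` [set` F ++ B]) a (ends (e : edge G)).1.
      by apply: sub_reach r => d /= nd; rewrite mem_cat orbC -mem_cat.
    have [B1 [F1 [a1 [b1 [ext1 e1 _]]]]] :=
      extend_through (extendable_sym ext) eS' ez r'.
    exists F1, B1, b1, a1; split; first exact: extendable_sym.
    by move: e1; rewrite !mem_cat => /orP[]->; rewrite !orbT.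
  have [B1 [F1 [a1 [b1 [ext1 e1 _]]]]] := extend_through ext eS ez r.
  exists B1, F1, a1, b1; split=> //.
  by move: e1; rewrite !mem_cat => /orP[]->; rewrite !orbT.
have [B2 [F2 [a2 [b2 [ext2 F2N]]]]] := extend_end ext1.
have [F3 [B3 [b3 [a3 [/extendable_sym ext3 B3N]]]]] :=
  extend_end (extendable_sym ext2).
exists (B1 ++ B2 ++ B3), (F1 ++ F2 ++ F3), a3, b3; rewrite !catA.
split=> //.
- by move: B3N; rewrite -!size_eq0 !size_cat; lia.
- by move: F2N; rewrite -!size_eq0 !size_cat; lia.
- by move: e1; rewrite !mem_cat => /orP[]/orP[]->; rewrite ?orbT.
Qed.

End Extension.

(** * Finite paths as walks *)

Section Paths.
Variable G : graph.
Local Notation V := {classic (vertex G)}.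
Local Notation E := {classic (edge G)}.
Implicit Types (u v w x y z a b : V) (e d g : E) (p q s : seq E) (S : set E).

Definition other_end u e : V :=
  if (ends (e : edge G)).1 == u :> V then (ends (e : edge G)).2
  else (ends (e : edge G)).1.

Definition end_vertex u s : V := foldl other_end u s.

Lemma other_endP e u v : joins e u v -> other_end u e = v.
Proof.
rewrite /other_end => -[] -> /=; first by rewrite eqxx.
by case: eqP.
Qed.

Lemma walk_end u s v : walk u s v -> end_vertex u s = v.
Proof.
elim: s u => [|e s IH] u //= [w euw /IH <-].
by rewrite /end_vertex /= (other_endP euw).
Qed.

Lemma walk_take u s v i :
  walk u s v -> walk u (take i s) (end_vertex u (take i s)).
Proof.
rewrite -{1}(cat_take_drop i s) => /walk_cat[w wt _].
by rewrite (walk_end wt).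
Qed.

Lemma walk_nth e0 u s v i : walk u s v -> i < size s ->
  joins (nth e0 s i) (end_vertex u (take i s)) (end_vertex u (take i.+1 s)).
Proof.
move=> ws lis; have := walk_take i.+1 ws.
rewrite (take_nth e0 lis) -cats1 => /walk_cat[w wt /walk1].
by rewrite -(walk_end wt).
Qed.

Lemma walk_of_vertices e0 (f : nat -> V) s :
  (forall i, i < size s -> joins (nth e0 s i) (f i) (f i.+1)) ->
  walk (f 0) s (f (size s)).
Proof.
elim: s f => [|e s IH] f //= fj; exists (f 1); first exact: (fj 0).
exact: (IH (fun i => f i.+1) (fun i => fj i.+1)).
Qed.

Lemma path_of_walk u s v : walk u s v -> uniq s ->
  exists t : finite_path G, initial_vertex t = u /\ final_vertex t = v.
Proof.
move=> ws us.
have pos (c : {c : int | (0 <= c < (size s)%:Z)%R}) : `|val c|%N < size s.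
  by case: c => c /=; lia.
pose vm (c : vertex (interval_graph 0 (size s)%:Z)) : vertex G :=
  end_vertex u (take `|val c|%N s).
pose em (c : edge (interval_graph 0 (size s)%:Z)) : edge G :=
  tnth (in_tuple s) (Ordinal (pos c)).
have em_nth e0 c : em c = nth e0 s `|val c|%N by rewrite /em (tnth_nth e0).
have hj (e : edge (interval_graph 0 (size s)%:Z))
    (x y : vertex (interval_graph 0 (size s)%:Z)) :
    joins e x y -> joins (em e) (vm x) (vm y).
  have e0 : E := em e.
  have base : joins (em e) (vm (ends e).1) (vm (ends e).2).
    rewrite (em_nth e0) /vm /=.
    have -> : `|(val e + 1)%R|%N = `|val e|%N.+1 by move: (valP e) => /=; lia.
    exact: walk_nth ws (pos e).
  by case=> eE; move: base; rewrite eE //= => /joinsC.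
have inj : injective (emap (@Defs.Hom _ G vm em hj)).
  move=> c1 c2 /=; have e0 : E := em c1.
  rewrite !(em_nth e0) => /(congr1 (fun e : E => index e s)).
  rewrite !index_uniq ?pos // => c12.
  apply: val_inj; move: c12 (valP c1) (valP c2) => /=; lia.
have le0 : (0 <= (size s)%:Z)%R by [].
exists (FinitePath le0 (Trail inj)); split.
  by rewrite /initial_vertex /= /vm /= take0.
by rewrite /final_vertex /= /vm /= take_size (walk_end ws).
Qed.

(** The positions of the edges and vertices in the list serve to check that a
two-way infinite path built from the list extends [t]. *)
Lemma walk_of_path (t : finite_path G) : exists s,
  [/\ walk (initial_vertex t) s (final_vertex t), uniq s,
      forall e, e \in s <-> visited_edges t e,
      size s = `|hi t - lo t|%N &
      (forall (c : edge (interval_graph (lo t) (hi t))) e0,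
        nth e0 s `|val c - lo t|%N = emap t c) /\
      (forall c : vertex (interval_graph (lo t) (hi t)),
        end_vertex (initial_vertex t) (take `|val c - lo t|%N s) = vmap t c)].
Proof.
pose n := `|hi t - lo t|%N; have lh := lo_le_hi t.
pose l := mkseq (fun i => (lo t + i%:Z)%R) n.
pose es : seq (edge (interval_graph (lo t) (hi t))) := pmap insub l.
have val_es : map val es = l.
  rewrite /es pmap_filter; last exact: insubK.
  apply/all_filterP/allP => c /mapP[i]; rewrite mem_iota => ilt ->.
  by rewrite isSome_insub; move: ilt; rewrite /n; lia.
have sz_es : size es = n by rewrite -(size_map val) val_es size_mkseq.
have nth_es c0 c : nth c0 es `|val c - lo t|%N = c.
  apply: val_inj; rewrite -(nth_map _ (val c0)) ?val_es.
    rewrite nth_mkseq; [move: (valP c) => /=; lia|].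
    by rewrite /n; move: (valP c) => /=; lia.
  by rewrite sz_es /n; move: (valP c) => /=; lia.
have u_es : uniq es.
  by rewrite -(map_inj_uniq val_inj) val_es mkseq_uniq // => i j /addrI[].
have pos (c : edge (interval_graph (lo t) (hi t))) : `|val c - lo t|%N < n.
  by rewrite /n; move: (valP c) => /=; lia.
pose s : seq E := map (emap t) es.
have nth_s c e0 : nth e0 s `|val c - lo t|%N = emap t c.
  by rewrite (nth_map c) ?sz_es ?pos // nth_es.
pose v0 : vertex (interval_graph (lo t) (hi t)) :=
  exist _ (lo t) (lo_subproof lh).
pose f i : V := vmap t (insubd v0 (lo t + i%:Z)%R).
have fE c : f `|val c - lo t|%N = vmap t c.
  congr vmap; apply: val_inj; rewrite val_insubd.
  by case: ifP; move: (valP c) => /=; lia.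
have fj e0 i : i < n -> joins (nth e0 s i) (f i) (f i.+1).
  move=> ilt; have ci : (lo t <= lo t + i%:Z < hi t)%R.
    by move: ilt; rewrite /n; lia.
  pose c : edge (interval_graph (lo t) (hi t)) :=
    exist (fun c => lo t <= c < hi t)%R _ ci.
  have iE : i = `|val c - lo t|%N by rewrite /=; lia.
  have -> : f i = vmap t (ends c).1 by rewrite -fE /= -iE.
  have -> : f i.+1 = vmap t (ends c).2.
    by rewrite -fE; congr f; rewrite /=; lia.
  by rewrite iE nth_s; apply: hom_joins; left; case: (ends c).
have sz_s : size s = n by rewrite size_map.
have ini : f 0 = initial_vertex t.
  by rewrite /initial_vertex -fE /=; congr f; lia.
have fin : f n = final_vertex t.
  by rewrite /final_vertex -fE /=.
have wt i : i <= n -> walk (f 0) (take i s) (f i).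
  move=> ilt; have szt : size (take i s) = i by rewrite size_take_min sz_s; lia.
  case: (posnP n) => [n0|ngt].
    have -> : i = 0 by lia.
    by rewrite take0.
  have ei : (lo t <= lo t < hi t)%R by move: ngt; rewrite /n; lia.
  pose c0 : edge (interval_graph (lo t) (hi t)) :=
    exist (fun c => lo t <= c < hi t)%R _ ei.
  pose e0 : E := emap t c0.
  rewrite -{2}szt; apply: (@walk_of_vertices e0) => j; rewrite szt => jlt.
  by rewrite nth_take //; apply: fj; lia.
exists s; split=> //.
- by rewrite -ini -fin -{1}(take_size s) sz_s; apply: wt.
- by rewrite map_inj_uniq //; apply: (@trail_inj _ _ t).
- move=> e; split=> [/mapP[c _ ->]|[c _ <-]]; first by exists c.
  apply/mapP; exists c => //.
  by rewrite -(nth_es c c) mem_nth // sz_es pos.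
- split=> // c; rewrite -ini -fE; apply: walk_end; apply: wt.
  by rewrite /n; move: (valP c) => /=; lia.
Qed.

Lemma connectedP : connected G <-> forall u v, reach setT u v.
Proof.
split=> cG u v.
  have [t [<- <-]] := cG u v; have [s [ws _ _ _ _]] := walk_of_path t.
  by exists s.
have [s ws _] := cG u v; have [s' [us' ws' _]] := walk_uniq ws.
exact: path_of_walk ws' us'.
Qed.

End Paths.

(** * Components of a subgraph *)

Definition edge_val (G : graph) (C : subgraph G) (c : {classic (edge C)}) :
  {classic (edge G)} := val (c : edge C).

Lemma edge_val_inj (G : graph) (C : subgraph G) : injective (@edge_val G C).
Proof. by move=> c c' /val_inj. Qed.

Section Components.
Local Open Scope card_scope.
Variable G : graph.
Local Notation V := {classic (vertex G)}.
Local Notation E := {classic (edge G)}.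
Implicit Types (u v w x y z a b : V) (e d g : E) (p q s : seq E).
Implicit Types (S : set E) (C K : subgraph G).

Lemma sub_joins C (e : edge C) (u v : vertex C) :
  joins e u v <-> @joins G (val e) (val u) (val v).
Proof.
rewrite /joins /=; split.
  by case=> -[<- <-] /=; [left|right]; case: (ends (val e)).
by case=> eE; [left|right]; congr pair; apply: val_inj => /=; rewrite eE.
Qed.

Lemma walk_val C (u v : vertex C) (s : seq {classic (edge C)}) :
  walk u s v -> @walk G (val u) (map (@edge_val _ C) s) (val v).
Proof.
elim: s u => [|e s IH] u /=; first by move=> ->.
by move=> [w /sub_joins euw /IH ws]; exists (val w).
Qed.

Lemma walk_lift C s (u : vertex C) (v : V) : @walk G (val u) s v ->
  (forall e, e \in s -> sub_edges C e) ->
  exists (v' : vertex C) (s' : seq {classic (edge C)}),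
    val v' = v /\ walk u s' v'.
Proof.
elim: s u => [|e s IH] u /=; first by move=> <- _; exists u, [::].
move=> [w euw ws] sC; have Ce : sub_edges C e by apply: sC; rewrite inE eqxx.
have Cw := sub_closed Ce (joins_incidentr euw).
pose w' : vertex C := SigSub (mem_set Cw).
pose e' : edge C := SigSub (mem_set Ce).
have [||v' [s' [v'E ws']]] := IH w' => //.
  by move=> d ds; apply: sC; rewrite inE ds orbT.
by exists v', (e' :: s'); split=> //; exists w' => //; apply/sub_joins.
Qed.

Lemma connected_subP C : connected C <->
  forall u v, sub_vertices C u -> sub_vertices C v -> reach (sub_edges C) u v.
Proof.
rewrite connectedP; split=> [cC u v Cu Cv|cC u v].
  have [s ws _] := cC (SigSub (mem_set Cu)) (SigSub (mem_set Cv)).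
  exists (map (@edge_val _ C) s); first exact: (walk_val ws).
  by move=> e /mapP[c _ ->]; apply: set_valP.
have [s ws sC] := cC _ _ (set_valP u) (set_valP v).
have [v' [s' [/val_inj <- ws']]] := walk_lift ws sC.
by exists s'.
Qed.

Lemma finite_subP C : finite_graph C <-> finite_set (sub_edges C).
Proof.
rewrite /finite_graph; split=> fC.
  apply: sub_finite_set (finite_image (fun e : edge C => val e) fC) => e Ce.
  by exists (SigSub (mem_set Ce)).
apply: sub_finite_set (finite_preimage (f := fun e : edge C => val e) _ fC).
  by move=> e _; apply: set_valP.
by move=> c c' _ _; apply: val_inj.
Qed.

Lemma comp_closed S z e v : comp_edges S z e -> incident e v -> reach S z v.
Proof.
by move=> [Se [y ey r]] ev; apply: reach_trans r (reach_edge Se ey ev).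
Qed.

Definition comp_graph S z : subgraph G :=
  @Subgraph G [set y | reach S z y] (comp_edges S z) (@comp_closed S z).

Lemma comp_graph_sub S z e : S e -> incident e z ->
  is_subgraph (comp_graph S z) (edge_subgraph S).
Proof.
move=> Se ez; split=> [y /= r|d []//].
pose P y := exists2 e', S e' & incident e' y.
apply: (reach_ind (P := P) _ r); last by exists e.
by move=> d x1 x2 Sd dx _; exists d => //; apply: joins_incidentr dx.
Qed.

Lemma comp_graph_connected S z : connected (comp_graph S z).
Proof.
have [|rz _] := @comp_restrict _ S (comp_edges S z) z.
  by move=> d y Sd dy r _; split=> //; exists y.
apply/connected_subP => u v /rz ru /rz rv.
exact: reach_trans (reach_sym ru) rv.
Qed.

Lemma connected_sub_comp S z K : is_subgraph K (edge_subgraph S) ->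
  connected K -> sub_vertices K z -> is_subgraph K (comp_graph S z).
Proof.
move=> [_ KS] /connected_subP cK Kz.
have rz y : sub_vertices K y -> reach S z y.
  by move=> Ky; apply: sub_reach KS (cK _ _ Kz Ky).
split=> [y /rz //|d Kd]; split; first exact: KS.
exists (ends (d : edge G)).1; first by left.
by apply: rz; apply: sub_closed Kd _; left.
Qed.

(** Maximality: a connected subgraph containing [z] only has vertices that are
reachable from [z]. *)
Lemma component_comp S z e : S e -> incident e z ->
  component (edge_subgraph S) (comp_graph S z).
Proof.
move=> Se ez; split; first exact: comp_graph_sub ez.
  exact: comp_graph_connected.
move=> K KH cK [CK _]; apply: connected_sub_comp => //.
by apply: CK; apply: reach_refl.
Qed.

(** By maximality, as the edges reachable from [z] form a connected subgraph
containing [C]. *)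
Lemma comp_of_component S C z : component (edge_subgraph S) C ->
  sub_vertices C z -> comp_edges S z `<=` sub_edges C.
Proof.
move=> [CH cC maxC] Cz; have [e Se ez] := CH.1 _ Cz.
case: (maxC (comp_graph S z)) => //; first exact: comp_graph_sub ez.
  exact: comp_graph_connected.
exact: connected_sub_comp.
Qed.

(** The empty subgraph is connected, but it is not maximal. *)
Lemma component_nonempty S C e : S e -> component (edge_subgraph S) C ->
  exists z, sub_vertices C z.
Proof.
move=> Se [CH _ maxC]; apply: contrapT => nz.
have ez := incident_fst e.
apply nz; exists (ends (e : edge G)).1.
have [_ cK _] := component_comp Se ez.
case: (maxC _ (comp_graph_sub Se ez) cK); last first.
  by move=> + _; apply; apply: reach_refl.
split=> [z Cz|d Cd]; case: nz; first by exists z.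
by exists (ends (d : edge G)).1; apply: sub_closed Cd _; left.
Qed.

Lemma comp_incident S z e : comp_edges S z e -> exists2 d, S d & incident d z.
Proof.
move=> [Se [y ey [[|d q] /=]]]; first by move=> ->; exists e.
move=> [w dzw _] /(_ d); rewrite inE eqxx => /(_ isT) Sd.
by exists d => //; apply: joins_incidentl dzw.
Qed.

Lemma infinite_component_comp s z : ~ finite_set (comp_edges (~` [set` s]) z) ->
  infinite_components (remove_edges ([set` s] : set (edge G)))
    (comp_graph (~` [set` s]) z).
Proof.
move=> inf; split; last by move/finite_subP.
have [e /comp_incident[d Sd dz]] := infinite_setN0 inf.
exact: component_comp dz.
Qed.

Lemma comp_graph_inj S z z' : comp_graph S z = comp_graph S z' -> reach S z z'.
Proof.
move=> /(congr1 (@sub_vertices G)) /= /seteqP[_ /(_ z')]; apply.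
exact: reach_refl.
Qed.

Lemma card_le_pigeonhole T (A : set T) n (f : nat -> T) : A #<= `I_n ->
  (forall i, i <= n -> A (f i)) -> exists i j, [/\ i < j, j <= n & f i = f j].
Proof.
move=> An fA; apply: contrapT => nex.
suff : `I_n.+1 #<= `I_n by rewrite card_le_II ltnn.
apply: card_le_trans An.
apply: (@card_le_trans _ _ _ (f @` `I_n.+1)); last first.
  by apply: subset_card_le => _ [i /= iln <-]; apply: fA.
have inj : {in `I_n.+1 &, injective f}.
  move=> i j; rewrite !inE /= => iln jln fij; apply: contrapT => /eqP.
  rewrite neq_ltn => /orP[ij|ji]; apply: nex; first by exists i, j.
  by exists j, i.
by rewrite (card_le_eqr (inj_card_eq inj)).
Qed.

(** A loop at [v] counts twice in [degree], and its two ends cancel in [parity];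
any other edge at [v] counts once in both. *)
Lemma degree_parity v (L : seq E) :
  uniq L -> (forall e, incident e v -> e \in L) ->
  exists n : nat, degree v = Some n /\ odd n = parity L v.
Proof.
move=> uL vL.
have fin : finite_set [set e : edge G | incident e v].
  by apply: sub_finite_set (finite_seq L) => e /vL.
have cnt (P : E -> Prop) : (forall e, P e -> incident e v) ->
    size (finmap.enum_fset (fset_set ([set e | P e] : set E))) =
    count (fun e => `[< P e >]) L.
  move=> Pv; rewrite -size_filter; apply: perm_size; apply: uniq_perm.
  - exact: finmap.fset_uniq.
  - exact: filter_uniq.
  move=> e; rewrite in_fset_set; last by apply: sub_finite_set fin => d /Pv.
  rewrite mem_filter; apply/idP/idP => [/set_mem /= Pe|/andP[/asboolP Pe _]].
    by rewrite (vL _ (Pv _ Pe)) andbT; apply/asboolP.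
  exact/mem_set.
rewrite /degree asboolT //; eexists; split; first reflexivity.
rewrite (cnt (fun e => incident e v)) // (cnt (fun e => loop e v)); last first.
  by move=> e; rewrite /loop /incident => ->; left.
elim: L {uL vL cnt fin} => [|e L IH] /=; first by rewrite parity_nil.
rewrite parity_cons -IH addnACA oddD; congr addb.
rewrite /parity big_seq1 /incident /loop; case: (ends (e : edge G)) => x y /=.
have [->|/eqP xv] := eqVneq (x : V) v; have [->|/eqP yv] := eqVneq (y : V) v.
- by rewrite !asboolT //; left.
- by rewrite asboolT ?asboolF //; [case|left].
- by rewrite asboolT ?asboolF //; [case|right].
- by rewrite !asboolF //; case.
Qed.

End Components.

(** * Ends and parities from [property_E2] *)

Section Property.
Local Open Scope card_scope.
Variable G : graph.
Local Notation V := {classic (vertex G)}.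
Local Notation E := {classic (edge G)}.

Lemma E2_finite_degrees_even : property_E2 G -> finite_degrees_even G.
Proof.
move=> [_ _ deg _ _] x L uL xL; have [d [dE <-]] := degree_parity uL xL.
case: (deg x) => [|[d']]; first by rewrite /infinite_degree dE.
by rewrite dE => -[->] /negbTE.
Qed.

Lemma E2_at_most_two_ends : property_E2 G -> at_most_two_ends G.
Proof.
move=> [_ _ _ ne _] s z1 z2 z3 S i1 i2 i3.
have bd :
    infinite_components (remove_edges ([set` s] : set (edge G))) #<= `I_2.
  case: ne => -[bd _]; last by apply: bd; exact: (@finite_seq E s).
  by apply: card_le_trans (bd _ (@finite_seq E s)) _; rewrite card_le_II.
have [|i [j [ij jlt]]] := card_le_pigeonhole
    (f := fun i => comp_graph S (nth z3 [:: z1; z2] i)) bd.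
  by move=> [|[|[|i]]] //= _; apply: infinite_component_comp.
move: i j ij jlt => [|[|i]] [|[|[|j]]] // _ _ /= /comp_graph_inj r.
- by apply: Or31.
- by apply: Or32.
- by apply: Or33.
Qed.

Lemma lift_edges (C : subgraph G) (s : seq E) :
  (forall e, e \in s -> sub_edges C e) ->
  exists L : seq {classic (edge C)}, map (@edge_val _ C) L = s.
Proof.
elim: s => [|e s IH] sC; first by exists [::].
have [d ds|L <-] := IH; first by apply: sC; rewrite inE ds orbT.
have Ce : sub_edges C e by apply: sC; rewrite inE eqxx.
by exists ((SigSub (mem_set Ce) : edge C) :: L).
Qed.

Lemma parity_val (C : subgraph G) (L : seq {classic (edge C)}) (v : vertex C) :
  parity L v = parity (map (@edge_val _ C) L) (val v : V).
Proof.
rewrite /parity big_map; apply: eq_bigr => c _ /=.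
have eqv (x y : vertex C) :
    (x == y :> {classic (vertex C)}) = (val x == val y :> V).
  by apply/eqP/eqP => [->//|]; apply: val_inj.
by rewrite !eqv.
Qed.

Lemma even_edge_subgraph (s : seq E) :
  uniq s -> (forall x, parity s x = false) ->
  forall v : vertex (edge_subgraph ([set` s] : set (edge G))), even_degree v.
Proof.
move=> us ps v; set H := edge_subgraph _ in v *.
have [//|L LE] := @lift_edges H s.
have uL : uniq L by apply: (@map_uniq _ _ (@edge_val G H)); rewrite LE.
have [|d [dE dodd]] := @degree_parity H v L uL.
  move=> e _; have : edge_val e \in s by apply: (set_valP e).
  by rewrite -LE => /mapP[c cL /edge_val_inj ->].
by exists d => //; rewrite dodd parity_val LE ps.
Qed.

Lemma E2_even_removal_one_end : property_E2 G -> even_removal_one_end G.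
Proof.
move=> [_ _ _ _ one] s z1 z2 us ps S i1 i2.
have := one _ (@finite_seq E s) (even_edge_subgraph us ps).
rewrite card_eq_le => /andP[le1 _].
have [|i [j [ij jlt]]] := card_le_pigeonhole
    (f := fun i => comp_graph S (nth z2 [:: z1] i)) le1.
  by move=> [|[|i]] //= _; apply: infinite_component_comp.
by move: i j ij jlt => [|i] [|[|j]] // _ _ /= /comp_graph_inj r.
Qed.

End Property.

(** * Limits of growing trails *)

Section Limit.
Variables (T : eqType) (x0 : T) (L : nat -> seq T).
Hypothesis grow : forall n, exists2 M, M != [::] & L n.+1 = L n ++ M.

(** Stage [i.+1] has length at least [i.+1], so [x0] is never read. *)
Definition limit_seq i : T := nth x0 (L i.+1) i.

Lemma grow_size n : n <= size (L n).
Proof.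
elim: n => // n IH; have [M M0 ->] := grow n.
by rewrite size_cat; move: M0; rewrite -size_eq0; lia.
Qed.

Lemma grow_prefix n m : n <= m -> exists M, L m = L n ++ M.
Proof.
elim: m => [|m IH].
  by rewrite leqn0 => /eqP ->; exists [::]; rewrite cats0.
rewrite leq_eqVlt => /predU1P[->|/IH[M LM]].
  by exists [::]; rewrite cats0.
by have [M' _ ->] := grow m; exists (M ++ M'); rewrite LM catA.
Qed.

Lemma limit_seqE n i : i < size (L n) -> nth x0 (L n) i = limit_seq i.
Proof.
move=> iln; rewrite /limit_seq; case: (leqP n i.+1) => ni.
  by have [M ->] := grow_prefix ni; rewrite nth_cat iln.
have [M ->] := grow_prefix (ltnW ni).
by rewrite nth_cat (leq_trans _ (grow_size i.+1)).
Qed.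

Lemma take_limit n i : i <= size (L n) -> take i (L n) = mkseq limit_seq i.
Proof.
move=> iln; apply: (@eq_from_nth _ x0); first by rewrite size_mkseq size_takel.
move=> j; rewrite size_takel // => ji; rewrite nth_take // nth_mkseq //.
by rewrite (limit_seqE (n := n)) // (leq_trans ji).
Qed.

Lemma mem_limit i n : i < n -> limit_seq i \in L n.
Proof.
move=> iltn; have ilt : i < size (L n) := leq_trans iltn (grow_size n).
by rewrite -(limit_seqE ilt) mem_nth.
Qed.

Lemma limit_mem n x : x \in L n -> exists i, limit_seq i = x.
Proof.
move=> xn; exists (index x (L n)).
by rewrite -(limit_seqE (n := n)) ?index_mem // nth_index.
Qed.

Lemma limit_inj : (forall n, uniq (L n)) -> injective limit_seq.
Proof.
move=> uL i j; have lt k : k <= maxn i j -> k < size (L (maxn i j).+1).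
  by move=> kl; apply: leq_trans (grow_size _).
rewrite -!(limit_seqE (n := (maxn i j).+1)) ?lt ?leq_maxl ?leq_maxr // => /eqP.
by rewrite nth_uniq ?lt ?leq_maxl ?leq_maxr // => /eqP.
Qed.

End Limit.

Lemma limit_joins (G : graph) (e0 : {classic (edge G)})
    (L : nat -> seq {classic (edge G)}) (u : {classic (vertex G)}) :
  (forall n, exists2 M, M != [::] & L n.+1 = L n ++ M) ->
  (forall n, exists v, walk u (L n) v) -> forall i,
  joins (limit_seq e0 L i) (end_vertex u (mkseq (limit_seq e0 L) i))
    (end_vertex u (mkseq (limit_seq e0 L) i.+1)).
Proof.
move=> grow wL i; have lt := grow_size grow i.+1.
rewrite -!(take_limit e0 grow (n := i.+1)) //; last exact: ltnW.
by have [v wv] := wL i.+1; apply: walk_nth wv lt.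
Qed.

(** * Necessity *)

Section TwoWay.
Variable G : graph.
Local Notation V := {classic (vertex G)}.
Local Notation E := {classic (edge G)}.

Lemma ray_infinite (S : set E) (z : V) (f : nat -> E) (r : nat -> V) :
  injective f -> (forall i, S (f i)) ->
  (forall i, joins (f i) (r i) (r i.+1)) -> reach S z (r 0) ->
  ~ finite_set (comp_edges S z).
Proof.
move=> finj fS fr zr fin; apply: infinite_nat.
apply: sub_finite_set (finite_preimage (f := f) _ fin); last first.
  by move=> i j _ _; apply: finj.
move=> i _; split; first exact: fS.
exists (r i); first exact: joins_incidentl (fr i).
by elim: i => // i IH; apply: reach_trans IH (reach_joins (fS i) (fr i)).
Qed.

Variables (T : two_way_path G) (t : finite_path G).
Hypothesis eT : extends T t.

Lemma two_way_joins c : joins (emap T c) (vmap T c) (vmap T (c + 1)%R).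
Proof. by apply: hom_joins; left. Qed.

Lemma extends_visited c : visited_edges t (emap T c) <-> (lo t <= c < hi t)%R.
Proof.
split=> [[d _]|ci].
  by rewrite -eT.2 => /(@trail_inj _ _ T) <-; apply: (valP d).
by exists (exist (fun c : int => lo t <= c < hi t)%R c ci); rewrite // -eT.2.
Qed.

Lemma extends_necessary : eulerian T ->
  (forall C : subgraph G,
      component (remove_edges (visited_edges t)) C -> ~ finite_graph C) /\
  (exists e f : edge G,
      (incident e (final_vertex t) /\ ~ visited_edges t e) /\
      (f <> e /\ incident f (initial_vertex t) /\ ~ visited_edges t f)).
Proof.
move=> euT; have lh := lo_le_hi t.
have out c : ~~ (lo t <= c < hi t)%R -> ~ visited_edges t (emap T c).
  by move=> /negP nc /extends_visited.
split; last first.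
  exists (emap T (hi t)), (emap T (lo t - 1)%R); split; split.
  - rewrite /final_vertex -eT.1 /=; exact: joins_incidentl (two_way_joins _).
  - by apply: out; lia.
  - by move=> /(@trail_inj _ _ T); lia.
  - split; last by apply: out; lia.
    rewrite /initial_vertex -eT.1 /=.
    have := joins_incidentr (two_way_joins (lo t - 1)%R).
    by rewrite subrK.
move=> C cC /finite_subP fC; set S : set E := ~` visited_edges t.
have [z Cz] : exists z, sub_vertices C z.
  apply: (component_nonempty (e := emap T (hi t)) _ cC); apply: out; lia.
have [[/(_ z Cz) [d Sd dz] _] _ _] := cC.
have inf : ~ finite_set (comp_edges S z); last first.
  by apply: inf; apply: sub_finite_set fC; apply: comp_of_component cC Cz.
have [c [cd _]] := euT d; subst d.
have : ~~ (lo t <= c < hi t)%R by apply/negP => /extends_visited.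
rewrite negb_and -!ltNge -leNgt => /orP[clo|chi].
  apply: (@ray_infinite S z (fun i => emap T (c - i%:Z)%R)
    (fun i => vmap T (c + 1 - i%:Z)%R)).
  - by move=> i j /(@trail_inj _ _ T); lia.
  - by move=> i; apply: out; lia.
  - move=> i; apply: joinsC; have := two_way_joins (c - i%:Z)%R.
    by congr (joins _ (vmap T _) (vmap T _)); lia.
  - apply: reach_edge Sd dz _; rewrite subr0.
    exact: joins_incidentr (two_way_joins c).
apply: (@ray_infinite S z (fun i => emap T (c + i%:Z)%R)
  (fun i => vmap T (c + i%:Z)%R)).
- by move=> i j /(@trail_inj _ _ T); lia.
- by move=> i; apply: out; lia.
- move=> i; have := two_way_joins (c + i%:Z)%R.
  by congr (joins _ _ (vmap T _)); lia.
- apply: reach_edge Sd dz _; rewrite addr0.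
  exact: joins_incidentl (two_way_joins c).
Qed.

End TwoWay.

(** * Sufficiency *)

Section Glue.
Variable G : graph.
Local Notation V := {classic (vertex G)}.
Local Notation E := {classic (edge G)}.

(** Edges of the line are indexed by their left end, so if [u] has position [o]
then the backward ray starts with the edge of position [o - 1]. *)
Lemma glue_rays (o : int) (u : V) (b f : nat -> E) (vb vf : nat -> V) :
  vb 0 = u -> vf 0 = u ->
  (forall i, joins (b i) (vb i) (vb i.+1)) ->
  (forall i, joins (f i) (vf i) (vf i.+1)) ->
  injective b -> injective f -> (forall i j, b i <> f j) ->
  exists T : two_way_path G,
    [/\ forall i : nat, emap T (o + i%:Z)%R = f i,
        forall i : nat, vmap T (o + i%:Z)%R = vf i &
        forall i : nat, emap T (o - i.+1%:Z)%R = b i].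
Proof.
move=> vb0 vf0 jb jf binj finj bf.
pose em (c : edge int_graph) : edge G :=
  match (c - o)%R with Posz i => f i | Negz i => b i end.
pose vm (c : vertex int_graph) : vertex G :=
  match (c - o)%R with Posz i => vf i | Negz i => vb i.+1 end.
have hj (e x y : int) : @joins int_graph e x y -> joins (em e) (vm x) (vm y).
  have base : joins (em e) (vm e) (vm (e + 1)%R).
    rewrite /em /vm addrAC; case: (e - o)%R => i.
      by rewrite (_ : (Posz i + 1)%R = Posz i.+1); [apply: jf|lia].
    case: i => [|i].
      (* the two rays meet: position [o] belongs to the forward ray *)
      rewrite (_ : (Negz 0 + 1)%R = Posz 0) // vf0 -vb0.
      exact/joinsC/jb.
    by rewrite (_ : (Negz i.+1 + 1)%R = Negz i); [apply/joinsC/jb|lia].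
  by case=> -[<- <-] //; apply: joinsC.
have inj : injective (emap (@Defs.Hom int_graph G vm em hj)).
  move=> c d /=; rewrite /em.
  case cE: (c - o)%R => [i|i]; case dE: (d - o)%R => [j|j].
  - by move/finj; lia.
  - by move/esym/bf.
  - by move/bf.
  - by move/binj; lia.
exists (Trail inj); split=> i /=; rewrite /em /vm.
- by rewrite (_ : (o + i%:Z - o)%R = Posz i) //; lia.
- by rewrite (_ : (o + i%:Z - o)%R = Posz i) //; lia.
- by rewrite (_ : (o - i.+1%:Z - o)%R = Negz i) //; lia.
Qed.

Variable (hG : property_E2 G).

(** Stage [n] goes through the edge with code [n], or through [e0] if there is
none. *)
Lemma exhaust (u : V) (F0 : seq E) (a0 b0 : V) (e0 : E) (code : E -> nat) :
  injective code -> extendable u [::] F0 a0 b0 ->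
  exists B F : nat -> seq E,
    [/\ F 0 = F0,
        forall n, exists a b, extendable u (B n) (F n) a b,
        forall n, exists2 M, M != [::] & B n.+1 = B n ++ M,
        forall n, exists2 M, M != [::] & F n.+1 = F n ++ M &
        forall e, exists n, e \in B n ++ F n].
Proof.
move=> cinj ext0.
pose ok (X : seq E * seq E) := exists a b, extendable u X.1 X.2 a b.
pose state := {X : seq E * seq E | ok X}.
have next (x : nat * state) : exists y : state,
   [/\ exists2 M, M != [::] & (sval y).1 = (sval x.2).1 ++ M,
       exists2 M, M != [::] & (sval y).2 = (sval x.2).2 ++ M &
       forall e, code e = x.1 -> e \in (sval y).1 ++ (sval y).2].
  case: x => n [[B F] /= [a [b ext]]].
  have [e eP] : exists e, forall e', code e' = n -> e' = e.
    have [[e en]|ne] := pselect (exists e, code e = n).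
      by exists e => e' e'n; apply: cinj; rewrite en.
    by exists e0 => e' e'n; case: ne; exists e'.
  have [B1 [F1 [a' [b' [ext' B1N F1N eBF]]]]] :=
    extend_both_sides (E2_finite_degrees_even hG) (E2_at_most_two_ends hG)
      (E2_even_removal_one_end hG) e ext.
  have st : ok (B ++ B1, F ++ F1) by exists a', b'.
  by exists (exist ok _ st); split=> /=; [exists B1|exists F1|move=> e' /eP ->].
have [nxt nxtP] := choice next.
have st0 : ok ([::], F0) by exists a0, b0.
pose st := fix st n : state :=
  if n is m.+1 then nxt (m, st m) else exist ok _ st0.
exists (fun n => (sval (st n)).1), (fun n => (sval (st n)).2); split=> //=.
- by move=> n; apply: (svalP (st n)).
- by move=> n; have [] := nxtP (n, st n).
- by move=> n; have [] := nxtP (n, st n).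
- move=> e; exists (code e).+1; have [_ _] := nxtP (code e, st (code e)).
  exact.
Qed.

(** The base vertex is the initial vertex of [t]: the first forward list is [t]
and the first backward list is empty. *)
Lemma conditions_sufficient (t : finite_path G) :
  (forall C : subgraph G,
      component (remove_edges (visited_edges t)) C -> ~ finite_graph C) ->
  (exists e f : edge G,
      (incident e (final_vertex t) /\ ~ visited_edges t e) /\
      (f <> e /\ incident f (initial_vertex t) /\ ~ visited_edges t f)) ->
  exists T : two_way_path G, extends T t /\ eulerian T.
Proof.
move=> nf [e1 [f1 [[e1b e1S] [f1e1 [f1a f1S]]]]].
have [s [ws us sE s_sz [s_nth s_end]]] := walk_of_path t.
set u : V := initial_vertex t in ws s_end f1a *.
have visE : visited_edges t = [set` s].
  by apply/seteqP; split=> e /= /sE.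
rewrite visE in nf e1S f1S.
have ext0 : extendable u [::] s u (final_vertex t).
  split=> //=; last first.
    exists e1, f1; split=> //; [exact: nesym|exact/negP|exact/negP].
  move=> e z Se ez fin; apply: (nf (comp_graph (~` [set` s]) z)).
    exact: component_comp ez.
  exact/finite_subP.
have [[/countable_injP[code codeP] _] _ _ _ _] := hG.
have cinj : injective (code : E -> nat).
  by move=> e e'; apply: codeP; rewrite inE.
have [B [F [F0 extn growB growF all]]] := exhaust e1 cinj ext0.
pose b := limit_seq (e1 : E) B; pose f := limit_seq (e1 : E) F.
have walkB n : exists v, walk u (B n) v.
  by have [a [c g]] := extn n; exists a; apply: extendable_backward g.
have walkF n : exists v, walk u (F n) v.
  by have [a [c g]] := extn n; exists c; apply: extendable_forward g.
have jb := limit_joins e1 growB walkB.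
have jf := limit_joins e1 growF walkF.
have uBF n : uniq (B n ++ F n) by have [? [? []]] := extn n.
have binj : injective b.
  by apply: limit_inj => // n; move: (uBF n); rewrite cat_uniq => /and3P[].
have finj : injective f.
  by apply: limit_inj => // n; move: (uBF n); rewrite cat_uniq => /and3P[].
have bf i j : b i <> f j.
  move=> bfE; move: (uBF (maxn i j).+1).
  rewrite cat_uniq => /and3P[_ /hasPn dis _].
  have fj : f j \in F (maxn i j).+1.
    by apply: mem_limit => //; rewrite ltnS leq_maxr.
  move/negP: (dis _ fj); apply; rewrite -bfE.
  by apply: mem_limit => //; rewrite ltnS leq_maxl.
have [T [Tf Tvf Tb]] := @glue_rays (lo t) u b f
  (fun i => end_vertex u (mkseq b i)) (fun i => end_vertex u (mkseq f i))
  erefl erefl jb jf binj finj bf.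
exists T; split.
  split=> c.
    have cE : val c = (lo t + `|val c - lo t|%N%:Z)%R.
      by move: (valP c) => /=; lia.
    rewrite {1}cE Tvf -s_end -F0; congr (end_vertex u).
    rewrite -(take_limit (e1 : E) growF (n := 0)) // F0 s_sz.
    by move: (valP c) => /=; lia.
  have cE : val c = (lo t + `|val c - lo t|%N%:Z)%R.
    by move: (valP c) => /=; lia.
  rewrite {1}cE Tf -(s_nth c e1) -F0 (limit_seqE (e1 : E) growF) // F0 s_sz.
  by move: (valP c) => /=; lia.
move=> e; have [c cE] : exists c : int, emap T c = e.
  have [n] := all e; rewrite mem_cat => /orP[] /limit_mem.
    by move=> /(_ (e1 : E) growB)[i <-]; exists (lo t - i.+1%:Z)%R.
  by move=> /(_ (e1 : E) growF)[i <-]; exists (lo t + i%:Z)%R.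
by exists c; split=> // c'; rewrite -cE => /(@trail_inj _ _ T) ->.
Qed.

End Glue.

Theorem theorem4 (G : graph) (hG : property_E2 G) (t : finite_path G) :
  (exists T : two_way_path G, extends T t /\ eulerian T) <->
  ((forall C : subgraph G,
      component (remove_edges (visited_edges t)) C -> ~ finite_graph C) /\
   (exists e f : edge G,
      (incident e (final_vertex t) /\ ~ visited_edges t e) /\
      (f <> e /\ incident f (initial_vertex t) /\ ~ visited_edges t f))).
Proof.
split=> [[T [eT euT]]|[nf ef]]; first exact: extends_necessary eT euT.
exact: conditions_sufficient.
Qed.
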